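(* Let $(M,\phi,\xi,\eta,g)$ be a contact metric $(\kappa,\mu)$-space which is not $K$-contact, and let $\lambda=\sqrt{1-\kappa}$. Then the canonical invariants associated to the Legendrian foliations $\mathcal{F}_\lambda$ and $\mathcal{F}_{-\lambda}$ are given by $$\Pi_{\mathcal{F}_\lambda}=\frac{(\lambda+1)^2-\kappa-\mu\lambda}{\lambda}\,g|_{\mathcal{F}_\lambda\times\mathcal{F}_\lambda}\quad\text{and}\quad \Pi_{\mathcal{F}_{-\lambda}}=\frac{-(\lambda-1)^2+\kappa-\mu\lambda}{\lambda}\,g|_{\mathcal{F}_{-\lambda}\times\mathcal{F}_{-\lambda}},$$ respectively.
   Context: Conventions: $d\eta(V,W)=\frac12\big(V(\eta(W))-W(\eta(V))-\eta([V,W])\big)$; $R_{VW}=[\nabla_V,\nabla_W]-\nabla_{[V,W]}$ with $\nabla$ the Levi-Civita connection. A contact metric manifold is a $(2n+1)$-dimensional Riemannian manifold $(M,g)$ with a $(1,1)$-tensor field $\phi$, a $1$-form $\eta$ and a vector field $\xi$ (the Reeb vector field) such that $\eta(\xi)=1$, $\phi^2V=-V+\eta(V)\xi$, $g(\phi V,\phi W)=g(V,W)-\eta(V)\eta(W)$ and $d\eta=\Phi$, where $\Phi(V,W)=g(V,\phi W)$. Put $\mathcal{D}=\ker\eta$ and $h=\frac12\mathcal{L}_\xi\phi$ (Lie derivative). It is $K$-contact if $\xi$ is Killing, equivalently $h\equiv0$. A contact metric $(\kappa,\mu)$-space is a contact metric manifold such that for some real numbers $\kappa,\mu$ and all vector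 fields $V,W$, $$R_{VW}\xi=\kappa(\eta(W)V-\eta(V)W)+\mu(\eta(W)hV-\eta(V)hW).$$ It is known that $\kappa\le1$, that $\kappa=1$ implies $h=0$ (Sasakian), and that for $\kappa<1$ the eigenvalues of $h$ are $0,\pm\lambda$ with $\lambda=\sqrt{1-\kappa}$, with mutually orthogonal integrable eigendistributions $\mathbb{R}\xi$, $\mathcal{D}_\lambda$, $\mathcal{D}_{-\lambda}$; the last two are Legendrian, and the Legendrian foliations they define are denoted $\mathcal{F}_\lambda$, $\mathcal{F}_{-\lambda}$. A Legendrian foliation $\mathcal{F}$ is a foliation whose tangent bundle $T\mathcal{F}$ is an $n$-dimensional subbundle of $\mathcal{D}$ with $d\eta(X,X')=0$ for all $X,X'\in\Gamma(T\mathcal{F})$. Its canonical invariant is the symmetric bilinear form on $T\mathcal{F}$ given by $\Pi_{\mathcal{F}}(X,X')=-(\mathcal{L}_X\mathcal{L}_{X'}\eta)(\xi)=-\eta([X',[X,\xi]])$. The notation $g|_{\mathcal{F}\times\mathcal{F}}$ means the restriction of $g$ to $T\mathcal{F}$. *)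

(* Defs.v *)
From HB Require Import structures.
From mathcomp Require Import all_boot all_order all_algebra.
From mathcomp Require Import all_classical all_reals all_analysis.
From mathcomp Require Import ring.
Set Implicit Arguments.
Unset Strict Implicit.
Unset Printing Implicit Defensive.
Import Order.TTheory GRing.Theory Num.Theory.
Import numFieldNormedType.Exports.
Local Open Scope classical_set_scope.
Local Open Scope ring_scope.

Section Euclidean.
Context {R : realType} {m : nat}.
Implicit Types (U : set 'rV[R]_m) (f g : 'rV[R]_m -> R).

(* All iterated directional derivatives of order at most [k] exist and are
   continuous on [U]. *)
Fixpoint of_class_C (k : nat) U f : Prop :=
  (forall x, U x -> {for x, continuous f}) /\
  (if k is k'.+1 then
     (forall x v, U x -> derivable f x v) /\
     (forall v, of_class_C k' U (fun x => 'D_v f x))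
   else True).

Definition smooth_on U f := forall k, of_class_C k U f.

Lemma of_class_C_continuous k U f x :
  of_class_C k U f -> U x -> {for x, continuous f}.
Proof. by case: k => [|k] [+ _] Ux; apply. Qed.

Lemma of_class_CW k U f : of_class_C k.+1 U f -> of_class_C k U f.
Proof.
elim: k f => [|k IH] f; first by case.
by case=> cf [df Df]; split=> //; split=> // v; apply/IH/Df.
Qed.

Lemma of_class_C_ext k U f g : open U -> {in U, f =1 g} ->
  of_class_C k U f -> of_class_C k U g.
Proof.
move=> oU.
have nfg f' g' x : {in U, f' =1 g'} -> U x -> \forall y \near x, f' y = g' y.
  move=> fg Ux; have /filterS : nbhs x U by exact: open_nbhs_nbhs.
  by apply=> y Uy; apply: fg; rewrite inE.
have cfg f' g' : {in U, f' =1 g'} -> (forall x, U x -> {for x, continuous f'}) ->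
    forall x, U x -> {for x, continuous g'}.
  move=> fg cf x Ux; have := cf x Ux; rewrite /prop_for /continuous_at.
  rewrite (fg x) ?inE//; apply: cvg_trans.
  exact: near_eq_cvg (nfg _ _ _ fg Ux).
elim: k f g => [|k IH] f g fg /= [cf]; first by split=> //; exact: cfg cf.
move=> [df Df]; split; first exact: cfg cf.
split=> [x v Ux|v].
  by apply: near_eq_derivable (df x v Ux); exact: nfg fg Ux.
by apply: IH (Df v) => x /[!inE] Ux; exact/near_eq_derive/nfg.
Qed.

Lemma of_class_C_cst k U c : of_class_C k U (cst c).
Proof.
elim: k c => [|k IH] c; split=> //; try by move=> x _; exact: cst_continuous.
split=> [x v _|v]; first exact: derivable_cst.
rewrite (_ : (fun x => _) = cst 0); first exact: IH.
by apply/funext => x; rewrite derive_cst.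
Qed.

Lemma of_class_CB k U f g : open U ->
  of_class_C k U f -> of_class_C k U g -> of_class_C k U (f - g).
Proof.
move=> oU; elim: k f g => [|k IH] f g [cf Hf] [cg Hg].
  by split=> // x Ux; apply: continuousB; [exact: cf | exact: cg].
split; first by move=> x Ux; apply: continuousB; [exact: cf | exact: cg].
move: Hf Hg => [df Df] [dg Dg]; split=> [x v Ux|v].
  by apply: derivableB; [exact: df | exact: dg].
apply: of_class_C_ext (IH _ _ (Df v) (Dg v)) => // x /[!inE] Ux.
by rewrite /= deriveB; [|exact: df | exact: dg].
Qed.

Lemma of_class_CD k U f g : open U ->
  of_class_C k U f -> of_class_C k U g -> of_class_C k U (f + g).
Proof.
move=> oU Cf Cg; rewrite -[g]opprK -[- g]sub0r.
apply: of_class_CB => //; apply: of_class_CB => //; exact: of_class_C_cst.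
Qed.

Lemma of_class_CM k U f g : open U ->
  of_class_C k U f -> of_class_C k U g -> of_class_C k U (f * g).
Proof.
move=> oU; elim: k f g => [|k IH] f g Cf Cg; split=> //.
- by move=> x Ux; apply: continuousM;
    [exact: of_class_C_continuous Cf _ | exact: of_class_C_continuous Cg _].
- by move=> x Ux; apply: continuousM;
    [exact: of_class_C_continuous Cf _ | exact: of_class_C_continuous Cg _].
have [_ [df Df]] := Cf; have [_ [dg Dg]] := Cg; split=> [x v Ux|v].
  by apply: derivableM; [exact: df | exact: dg].
apply: (@of_class_C_ext _ _
    (f * (fun x => 'D_v g x) + g * (fun x => 'D_v f x))) => //.
  move=> x /[!inE] Ux; rewrite /= deriveM; [|exact: df|exact: dg].
  by rewrite !fctE.
by apply: of_class_CD => //; apply: IH;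
  [exact: of_class_CW | exact: Dg | exact: of_class_CW | exact: Df].
Qed.

End Euclidean.

Section Manifolds.
Context {R : realType} {m : nat}.

Record chart (T : topologicalType) := Chart {
  chart_dom : set T;
  chart_map :> T -> 'rV[R]_m;
  chart_inv : 'rV[R]_m -> T;
  chart_dom_open : open chart_dom;
  chart_img_open : open (chart_map @` chart_dom);
  chart_mapK : {in chart_dom, cancel chart_map chart_inv};
  chart_map_continuous : forall p, chart_dom p -> {for p, continuous chart_map};
  chart_inv_continuous :
    forall x, (chart_map @` chart_dom) x -> {for x, continuous chart_inv} }.

Definition smoothly_compatible T (c d : chart T) :=
  forall j : 'I_m,
    smooth_on (c @` (chart_dom c `&` chart_dom d))
      (fun x => d (chart_inv c x) ord0 j).

End Manifolds.

Record manifold (R : realType) (m : nat) := Manifold {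
  manifold_carrier :> topologicalType;
  manifold_hausdorff : hausdorff_space manifold_carrier;
  manifold_second_countable : @second_countable manifold_carrier;
  atlas : set (@chart R m manifold_carrier);
  atlas_cover : forall p, exists2 c, atlas c & chart_dom c p;
  atlas_compatible :
    forall c d, atlas c -> atlas d -> smoothly_compatible c d }.

Section SmoothFunctions.
Context {R : realType} {m : nat} (M : manifold R m).

Definition smooth_pred : {pred M -> R} := fun f =>
  `[< forall c, atlas c -> smooth_on (c @` chart_dom c) (f \o chart_inv c) >].

Record smooth_fun := SmoothFun {
  smooth_fun_val :> M -> R;
  smooth_fun_valP : smooth_fun_val \in smooth_pred }.

HB.instance Definition _ := [isSub for smooth_fun_val].
HB.instance Definition _ := [Choice of smooth_fun by <:].

Lemma smooth_pred_cst (c : R) : cst c \in smooth_pred.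
Proof. by apply/asboolP => d _ k; exact: of_class_C_cst. Qed.

Lemma smooth_pred_subring : subring_closed smooth_pred.
Proof.
split=> [|f g /asboolP Cf /asboolP Cg|f g /asboolP Cf /asboolP Cg].
- exact: smooth_pred_cst.
- by apply/asboolP => c Ac k; apply: of_class_CB (Cf c Ac k) (Cg c Ac k);
    exact: chart_img_open.
- by apply/asboolP => c Ac k; apply: of_class_CM (Cf c Ac k) (Cg c Ac k);
    exact: chart_img_open.
Qed.

HB.instance Definition _ :=
  GRing.SubChoice_isSubComPzRing.Build (M -> R) smooth_pred smooth_fun
    smooth_pred_subring.

Definition smooth_cst (c : R) : smooth_fun := SmoothFun (smooth_pred_cst c).

End SmoothFunctions.

(* Vector fields are the R-linear derivations of the algebra of smooth
   functions, and tensor fields are maps that are linear over that algebra.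
   Since the manifold is Hausdorff and second countable, bump functions make
   these the same as smooth sections of the tensor bundles. *)
Section VectorFields.
Context {R : realType} {m : nat} (M : manifold R m).
Implicit Types f g : smooth_fun M.

Definition derivation (X : smooth_fun M -> smooth_fun M) : Prop :=
  [/\ forall f g, X (f + g) = X f + X g,
      forall (c : R) f, X (smooth_cst M c * f) = smooth_cst M c * X f
    & forall f g, X (f * g) = X f * g + f * X g].

Record vector_field := VectorField {
  vector_field_val :> smooth_fun M -> smooth_fun M;
  vector_field_valP : derivation vector_field_val }.

Implicit Types X Y Z : vector_field.

Lemma vector_fieldP X Y : (forall f, X f = Y f) -> X = Y.
Proof.
case: X Y => [X hX] [Y hY] /= /funext XY; rewrite -{Y}XY in hY *.
by congr VectorField; exact: Prop_irrelevance.
Qed.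

Lemma vector_fieldD X f g : X (f + g) = X f + X g.
Proof. by case: (vector_field_valP X). Qed.

Lemma vector_fieldZ X (c : R) f :
  X (smooth_cst M c * f) = smooth_cst M c * X f.
Proof. by case: (vector_field_valP X). Qed.

Lemma vector_fieldM X f g : X (f * g) = X f * g + f * X g.
Proof. by case: (vector_field_valP X). Qed.

HB.instance Definition _ := gen_eqMixin vector_field.
HB.instance Definition _ := gen_choiceMixin vector_field.

Fact vf_zero_derivation : derivation (fun=> 0).
Proof. by split=> *; rewrite ?addr0 ?mulr0 ?mul0r ?addr0. Qed.

Fact vf_add_derivation X Y : derivation (fun f => X f + Y f).
Proof.
split=> [f g|c f|f g]; first by rewrite !vector_fieldD addrACA.
- by rewrite !vector_fieldZ mulrDr.
- by rewrite !vector_fieldM mulrDl mulrDr addrACA.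
Qed.

Fact vf_opp_derivation X : derivation (fun f => - X f).
Proof.
split=> [f g|c f|f g]; first by rewrite vector_fieldD opprD.
- by rewrite vector_fieldZ mulrN.
- by rewrite vector_fieldM mulNr mulrN opprD.
Qed.

Fact vf_scale_derivation f X : derivation (fun g => f * X g).
Proof.
split=> [g k|c g|g k]; first by rewrite vector_fieldD mulrDr.
- by rewrite vector_fieldZ mulrCA.
- by rewrite vector_fieldM mulrDr mulrA (mulrCA f g).
Qed.

Fact lie_bracket_derivation X Y : derivation (fun f => X (Y f) - Y (X f)).
Proof.
split=> [f g|c f|f g]; first by rewrite !vector_fieldD opprD addrACA.
- by rewrite !vector_fieldZ mulrBr.
- by rewrite !(vector_fieldM, vector_fieldD); ring.
Qed.

Definition vf_zero := VectorField vf_zero_derivation.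
Definition vf_add X Y := VectorField (vf_add_derivation X Y).
Definition vf_opp X := VectorField (vf_opp_derivation X).
Definition vf_scale f X := VectorField (vf_scale_derivation f X).
Definition lie_bracket X Y := VectorField (lie_bracket_derivation X Y).

Fact vf_addA : associative vf_add.
Proof. by move=> X Y Z; apply: vector_fieldP => f /=; rewrite addrA. Qed.
Fact vf_addC : commutative vf_add.
Proof. by move=> X Y; apply: vector_fieldP => f /=; rewrite addrC. Qed.
Fact vf_add0 : left_id vf_zero vf_add.
Proof. by move=> X; apply: vector_fieldP => f /=; rewrite add0r. Qed.
Fact vf_addN : left_inverse vf_zero vf_opp vf_add.
Proof. by move=> X; apply: vector_fieldP => f /=; rewrite addNr. Qed.

HB.instance Definition _ :=
  GRing.isZmodule.Build vector_field vf_addA vf_addC vf_add0 vf_addN.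

Fact vf_scaleA f g X : vf_scale f (vf_scale g X) = vf_scale (f * g) X.
Proof. by apply: vector_fieldP => k /=; rewrite mulrA. Qed.
Fact vf_scale1 : left_id 1 vf_scale.
Proof. by move=> X; apply: vector_fieldP => k /=; rewrite mul1r. Qed.
Fact vf_scaleDr : right_distributive vf_scale +%R.
Proof. by move=> f X Y; apply: vector_fieldP => k /=; rewrite mulrDr. Qed.
Fact vf_scaleDl X : {morph vf_scale^~ X : f g / f + g}.
Proof. by move=> f g; apply: vector_fieldP => k /=; rewrite mulrDl. Qed.

HB.instance Definition _ :=
  GRing.Zmodule_isLmodule.Build (smooth_fun M) vector_field
    vf_scaleA vf_scale1 vf_scaleDr vf_scaleDl.

End VectorFields.

Section Riemannian.
Context {R : realType} {m : nat} (M : manifold R m).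
Implicit Types V W Z : vector_field M.

Record riemannian_metric := RiemannianMetric {
  metric :> vector_field M -> vector_field M -> smooth_fun M;
  metric_linear : forall V, scalar (metric V);
  metric_sym : forall V W, metric V W = metric W V;
  (* [V f p != 0] for some [f] says that [V] does not vanish at [p] *)
  metric_gt0 : forall V (p : M), (exists f, V f p != 0) -> 0 < metric V V p }.

(* [nabla] is C^oo-linear in its first argument; R-linearity in the second one
   follows from additivity and the Leibniz rule. *)
Record is_levi_civita (g : riemannian_metric)
    (nabla : vector_field M -> vector_field M -> vector_field M) : Prop := {
  connection_linear : forall W, linear (nabla^~ W);
  connectionD : forall V W Z, nabla V (W + Z) = nabla V W + nabla V Z;
  connectionM : forall V f W, nabla V (f *: W) = V f *: W + f *: nabla V W;
  torsion_free : forall V W, nabla V W - nabla W V = lie_bracket V W;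
  metric_compatible : forall V W Z,
    V (g W Z) = g (nabla V W) Z + g W (nabla V Z) }.

Definition curvature (nabla : vector_field M -> vector_field M -> vector_field M)
    V W Z : vector_field M :=
  nabla V (nabla W Z) - nabla W (nabla V Z) - nabla (lie_bracket V W) Z.

Definition lie_derivative_form V (w : vector_field M -> smooth_fun M) :
    vector_field M -> smooth_fun M :=
  fun W => V (w W) - w (lie_bracket V W).

Definition lie_derivative_endo V (t : vector_field M -> vector_field M) :
    vector_field M -> vector_field M :=
  fun W => lie_bracket V (t W) - t (lie_bracket V W).

Definition ext_derivative (w : vector_field M -> smooth_fun M) V W : smooth_fun M :=
  smooth_cst M 2^-1 * (V (w W) - W (w V) - w (lie_bracket V W)).

Definition killing (g : riemannian_metric) Z : Prop := forall V W,
  Z (g V W) = g (lie_bracket Z V) W + g V (lie_bracket Z W).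

End Riemannian.

Record contact_metric_manifold (R : realType) (n : nat) := ContactMetricManifold {
  cm_manifold :> manifold R (2 * n + 1);
  cm_metric : riemannian_metric cm_manifold;
  cm_phi : {linear vector_field cm_manifold -> vector_field cm_manifold};
  cm_eta : {scalar vector_field cm_manifold};
  cm_xi : vector_field cm_manifold;
  cm_eta_xi : cm_eta cm_xi = 1;
  cm_phi2 : forall V, cm_phi (cm_phi V) = - V + cm_eta V *: cm_xi;
  cm_metric_phi : forall V W,
    cm_metric (cm_phi V) (cm_phi W) = cm_metric V W - cm_eta V * cm_eta W;
  cm_contact : forall V W,
    ext_derivative cm_eta V W = cm_metric V (cm_phi W) }.

Section ContactMetric.
Context {R : realType} {n : nat} (M : contact_metric_manifold R n).
Implicit Types V W X Y : vector_field M.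

Definition cm_h : vector_field M -> vector_field M :=
  fun V => smooth_cst M 2^-1 *: lie_derivative_endo (cm_xi M) (cm_phi M) V.

Definition K_contact : Prop := killing (cm_metric M) (cm_xi M).

Definition is_kappa_mu_space
    (nabla : vector_field M -> vector_field M -> vector_field M)
    (kappa mu : R) : Prop := forall V W,
  curvature nabla V W (cm_xi M) =
    smooth_cst M kappa *: (cm_eta M W *: V - cm_eta M V *: W) +
    smooth_cst M mu *: (cm_eta M W *: cm_h V - cm_eta M V *: cm_h W).

(* Sections of the eigendistribution of [h] for the constant eigenvalue [a]. *)
Definition eigendistribution (a : R) : set (vector_field M) :=
  [set V | cm_h V = smooth_cst M a *: V].

(* [X] and [Y] are meant to be sections of a Legendrian foliation; there
   [eta [X, xi] = eta [Y, xi] = 0], so this is [- eta [Y, [X, xi]]]. *)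
Definition canonical_invariant X Y : smooth_fun M :=
  - lie_derivative_form X (lie_derivative_form Y (cm_eta M)) (cm_xi M).

End ContactMetric.

(* Main.v *)
Require Import Defs.
From HB Require Import structures.
From mathcomp Require Import all_boot all_order all_algebra.
From mathcomp Require Import all_classical all_reals all_analysis.
From mathcomp Require Import ring lra.
Import Order.TTheory GRing.Theory Num.Theory.
Import numFieldNormedType.Exports.
Local Open Scope classical_set_scope.
Local Open Scope ring_scope.

(** The invariant measures how the bracket with the Reeb field xi moves a leaf
direction out of the leaf. For sections X, X' of ker eta, the identity
d eta = g(., phi .) turns it into 2 g(X', phi [X, xi]), and since
[X, xi] = nabla_X xi - nabla_xi X, two ingredients are needed.

The first is the formula nabla_X xi = - phi X - phi (h X). Write
nabla xi = S - phi; the contact condition says precisely that S is symmetric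
([reeb_shape_sym]). The 2-form d eta is invariant under the flow of xi
([reeb_contact]), which expresses nabla_xi phi as - (S phi + phi S)
([nabla_reeb_phi_shape]). As nabla_xi phi anticommutes with phi, so does S
([phi_reeb_shape]); hence nabla_xi phi = 0 and h = phi S. It follows that h is
symmetric and anticommutes with phi.

The second is the value of g(X', phi (nabla_xi X)) when h X = a X and
h X' = a X'. It is read off the curvature R(xi, X) xi: computed from the
formula for nabla xi it contains - phi (nabla_xi h) X, whose product with X' is
- 2 a g(X', phi (nabla_xi X)), while the (kappa, mu)-condition gives
- (kappa + mu a) g(X, X'). With a^2 = 1 - kappa this leaves
2 g(X', phi (nabla_xi X)) = mu g(X, X') once a is invertible, and the invariant
is (2 + 2 a - mu) g(X, X') ([canonical_invariant_eigen]). Taking a = lambda and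
a = - lambda gives both formulas.

The division by a is legitimate because kappa < 1 ([kappa_lt1]): the same
curvature identity, compared with its conjugate by phi, gives
h^2 = (kappa - 1) phi^2, so |h X|^2 = (1 - kappa) |phi X|^2; if kappa >= 1 then
h = 0, and xi is Killing. *)

(** * Constants and vector fields *)

Section Constants.
Context {R : realType} {m : nat} {M : manifold R m}.
Implicit Types (c d : R) (f k : smooth_fun M) (U V W : vector_field M).
Local Notation cst := (smooth_cst M).

Lemma smooth_fun_ext f f' : (forall p, f p = f' p) -> f = f'.
Proof. by move=> ff'; apply/val_inj/funext. Qed.

Lemma smooth_cstD c d : cst (c + d) = cst c + cst d.
Proof. exact: smooth_fun_ext. Qed.

Lemma smooth_cstN c : cst (- c) = - cst c.
Proof. exact: smooth_fun_ext. Qed.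

Lemma smooth_cstM c d : cst (c * d) = cst c * cst d.
Proof. exact: smooth_fun_ext. Qed.

Lemma smooth_cst1 : cst 1 = 1.
Proof. exact: smooth_fun_ext. Qed.

Lemma smooth_cst_divK {c f} : c != 0 -> cst c * f = 0 -> f = 0.
Proof.
move=> c0 cf0; rewrite -[f]mul1r -smooth_cst1 -(mulVf c0) smooth_cstM -mulrA.
by rewrite cf0 mulr0.
Qed.

Lemma smooth_half f : cst 2^-1 * f + cst 2^-1 * f = f.
Proof.
rewrite -mulrDl -smooth_cstD (_ : 2^-1 + 2^-1 = 1 :> R) ?smooth_cst1 ?mul1r//.
lra.
Qed.

Lemma smooth_double_inj f : f + f = 0 -> f = 0.
Proof. by move=> ff; rewrite -(smooth_half f) -mulrDr ff mulr0. Qed.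

Lemma vector_field_half V : cst 2^-1 *: V + cst 2^-1 *: V = V.
Proof. by apply: vector_fieldP => f; exact: smooth_half. Qed.

Lemma vector_field_double_inj V : V + V = 0 -> V = 0.
Proof. by move=> VV; rewrite -(vector_field_half V) -scalerDr VV scaler0. Qed.

Lemma vector_field1 V : V 1 = 0.
Proof.
have := vector_fieldM V 1 1; rewrite !mulr1 mul1r => /eqP.
by rewrite -subr_eq subrr => /eqP.
Qed.

Lemma vector_field0 V : V 0 = 0.
Proof.
have := vector_fieldD V 0 0; rewrite addr0 => /eqP.
by rewrite -subr_eq subrr => /eqP.
Qed.

Lemma vector_fieldN V f : V (- f) = - V f.
Proof. by apply/eqP; rewrite -addr_eq0 -vector_fieldD addNr vector_field0. Qed.

Lemma vector_field_cst V c : V (cst c) = 0.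
Proof. by rewrite -[cst c]mulr1 vector_fieldZ vector_field1 mulr0. Qed.

(** A device for linear combinations: an equation follows from another one (or
from a combination of several) as soon as the differences of the two sides
agree, which is left to a ring normalization. *)
Lemma eq_from_subr {V : zmodType} {a b c d : V} : a = b -> c - d = a - b -> c = d.
Proof. by move=> -> /eqP; rewrite subrr subr_eq0 => /eqP. Qed.

Lemma vector_field_addE V W f : (V + W) f = V f + W f.
Proof. by []. Qed.

Lemma vector_field_oppE V f : (- V) f = - V f.
Proof. by []. Qed.

Lemma vector_field_scaleE k V f : (k *: V) f = k * V f.
Proof. by []. Qed.

Lemma vector_field_zeroE f : (0 : vector_field M) f = 0.
Proof. by []. Qed.

Definition vector_fieldE :=
  (vector_field_zeroE, vector_field_addE, vector_field_oppE, vector_field_scaleE).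

Lemma lie_bracketC V W : lie_bracket V W = - lie_bracket W V.
Proof. by apply: vector_fieldP => f /=; ring. Qed.

Lemma lie_bracket_jacobi U V W : lie_bracket U (lie_bracket V W) =
  lie_bracket (lie_bracket U V) W + lie_bracket V (lie_bracket U W).
Proof.
by apply: vector_fieldP => f /=; rewrite !(vector_fieldD, vector_fieldN); ring.
Qed.

End Constants.

(** * Bilinearity and positivity of the metric *)

Section Metric.
Context {R : realType} {m : nat} {M : manifold R m} (g : riemannian_metric M).
Implicit Types (f : smooth_fun M) (U V W : vector_field M).

Lemma metricDr U V W : g U (V + W) = g U V + g U W.
Proof. by have := metric_linear g U 1 V W; rewrite scale1r mul1r. Qed.

Lemma metric0r U : g U 0 = 0.
Proof.
have := metricDr U 0 0; rewrite addr0 => /eqP.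
by rewrite -subr_eq subrr => /eqP.
Qed.

Lemma metricZr U f V : g U (f *: V) = f * g U V.
Proof. by have := metric_linear g U f V 0; rewrite !addr0 metric0r addr0. Qed.

Lemma metricNr U V : g U (- V) = - g U V.
Proof. by rewrite -scaleN1r metricZr mulN1r. Qed.

Lemma metricDl U V W : g (V + W) U = g V U + g W U.
Proof. by rewrite -!(Defs.metric_sym g U) metricDr. Qed.

Lemma metricZl U f V : g (f *: V) U = f * g V U.
Proof. by rewrite -!(Defs.metric_sym g U) metricZr. Qed.

Lemma metricNl U V : g (- V) U = - g V U.
Proof. by rewrite -!(Defs.metric_sym g U) metricNr. Qed.

Definition metricE := (metricDr, metricZr, metricNr, metricDl, metricZl, metricNl).

(** Positivity is only given where a field does not vanish as a derivation, so
the contrapositive is used at a point where some derivative is nonzero. *)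
Lemma metric_definite V : g V V = 0 -> V = 0.
Proof.
move=> gV0; apply: vector_fieldP => f; apply: smooth_fun_ext => p.
apply/eqP/contraT => Vfp.
by have := @metric_gt0 _ _ _ g V p (ex_intro _ f Vfp); rewrite gV0 ltxx.
Qed.

Lemma metric_ext V W : (forall Z, g V Z = g W Z) -> V = W.
Proof.
move=> gVW; apply/eqP; rewrite -subr_eq0; apply/eqP/metric_definite.
by rewrite metricDl metricNl gVW subrr.
Qed.

(** Nonnegativity has to be obtained at a point p where V may act as zero on
every function, without knowing that g V V is then zero at p. Perturbing V by
t W, with W nonzero at p, gives a positive value for every t <> 0; the
polynomial obtained in t must then have a nonnegative constant term. *)
Lemma metric_ge0 V {W p f} : W f p != 0 -> 0 <= g V V p.
Proof.
move=> Wfp.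
have [[f' Vfp]|Vp] := pselect (exists f, V f p != 0).
  by apply/ltW/metric_gt0; exists f'.
have {}Vp k : V k p = 0.
  by apply/eqP/contraT => Vk; case: Vp; exists k.
have gt0 t : t != 0 -> 0 < g V V p + 2 * t * g V W p + t ^+ 2 * g W W p.
  move=> t0; set U := V + smooth_cst M t *: W.
  have : 0 < g U U p.
    apply: metric_gt0; exists f.
    rewrite [X in X != 0](_ : _ = V f p + t * W f p)//.
    by rewrite Vp add0r mulf_neq0.
  have -> : g U U = g V V + (smooth_cst M t * g V W + smooth_cst M t * g V W) +
      smooth_cst M t * (smooth_cst M t * g W W).
    by rewrite /U !metricE (Defs.metric_sym g W V); ring.
  rewrite [X in 0 < X -> _](_ : _ = g V V p + (t * g V W p + t * g V W p) +
    t * (t * g W W p))//.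
  lra.
have a_gt0 : 0 < g W W p by apply: metric_gt0; exists f.
rewrite leNgt; apply/negP => c0.
have ca_gt0 : 0 < - g V V p / g W W p by rewrite divr_gt0// oppr_gt0.
(* Averaging over t and - t removes the linear term; this t makes the quadratic
   term cancel the constant one. *)
set t := Num.sqrt (- g V V p / g W W p).
have t0 : t != 0 by rewrite gt_eqF// sqrtr_gt0.
have tt : t ^+ 2 * g W W p = - g V V p.
  by rewrite sqr_sqrtr ?divfK ?gt_eqF// ltW.
have := gt0 t t0; have := gt0 (- t); rewrite oppr_eq0 t0 sqrrN tt => /(_ isT).
lra.
Qed.

End Metric.

(** * The contact metric structure *)

Section ContactMetric.
Context {R : realType} {n : nat} {M : contact_metric_manifold R n}.
Implicit Types (f : smooth_fun M) (U V W X Y Z : vector_field M).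
Local Notation g := (cm_metric M).
Local Notation phi := (cm_phi M).
Local Notation eta := (cm_eta M).
Local Notation xi := (cm_xi M).

Lemma cm_phiD V W : phi (V + W) = phi V + phi W.
Proof. exact: linearD. Qed.

Lemma cm_phiN V : phi (- V) = - phi V.
Proof. exact: linearN. Qed.

Lemma cm_phiZ f V : phi (f *: V) = f *: phi V.
Proof. by rewrite linearZ. Qed.

(** Scaling is left out: a rewrite with it would unfold h, a multiple by 1/2, and
break the terms in which h must stay whole. *)
Definition cm_phiE := (cm_phiD, cm_phiN).

(** The contact condition cleared of the factor 1/2 in d eta. *)
Lemma contact_twice V W :
  V (eta W) - W (eta V) - eta (lie_bracket V W) = g V (phi W) + g V (phi W).
Proof. by rewrite -cm_contact /ext_derivative smooth_half. Qed.

Lemma metric_phi_skew V W : g V (phi W) = - g (phi V) W.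
Proof.
rewrite [in RHS]Defs.metric_sym -!cm_contact /ext_derivative.
by rewrite (lie_bracketC W V) raddfN; ring.
Qed.

Lemma phi_xi : phi xi = 0.
Proof.
apply: (@metric_definite _ _ _ g); rewrite metric_phi_skew.
by rewrite cm_phi2 cm_eta_xi scale1r addNr Defs.metric_sym metric0r oppr0.
Qed.

(** Evaluate phi^3 in the two ways that the formula for phi^2 allows. *)
Lemma eta_phi V : eta (phi V) = 0.
Proof.
have : phi (phi (phi V)) = - phi V + eta V *: phi xi.
  by rewrite (cm_phi2 V) linearD linearN linearZ.
rewrite cm_phi2 phi_xi scaler0 addr0 => /(canRL (addKr _)); rewrite opprK addrN.
by move=> /(congr1 eta); rewrite linearZ /= cm_eta_xi mulr1 linear0.
Qed.

Lemma metric_xi V : g V xi = eta V.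
Proof.
have := cm_metric_phi V xi; rewrite phi_xi metric0r cm_eta_xi mulr1.
by move=> /esym/eqP; rewrite subr_eq0 => /eqP.
Qed.

(** Invariance of eta under the Reeb flow: the contraction of d eta with xi is
g(xi, phi .) = eta o phi = 0. *)
Lemma reeb_eta W : xi (eta W) = eta (lie_bracket xi W).
Proof.
have := contact_twice xi W.
rewrite Defs.metric_sym metric_xi eta_phi addr0 cm_eta_xi vector_field1 subr0.
by move=> /eqP; rewrite subr_eq0 => /eqP.
Qed.

(** Invariance of d eta under the Reeb flow, by Cartan's argument: L_xi commutes
with d (this is the Jacobi identity) and L_xi eta = 0. *)
Lemma reeb_contact Y Z : xi (g Y (phi Z)) =
  g (lie_bracket xi Y) (phi Z) + g Y (phi (lie_bracket xi Z)).
Proof.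
rewrite -!cm_contact /ext_derivative -mulrDr vector_fieldZ.
congr (_ * _); rewrite !(vector_fieldD, vector_fieldN) !reeb_eta.
rewrite lie_bracket_jacobi linearD /=.
have bracket U f : xi (U f) = lie_bracket xi U f + U (xi f) by rewrite /= subrK.
by rewrite !bracket !reeb_eta; ring.
Qed.

(** All other terms of L_X L_X' eta vanish, because eta [Y, xi] = 0 for Y in
ker eta. *)
Lemma canonical_invariantE X X' : eta X = 0 -> eta X' = 0 ->
  canonical_invariant X X' =
    g X' (phi (lie_bracket X xi)) + g X' (phi (lie_bracket X xi)).
Proof.
move=> X0 X'0; rewrite -contact_twice /canonical_invariant /lie_derivative_form.
have Y0 Y : eta Y = 0 -> eta (lie_bracket Y xi) = 0.
  move=> Y0; rewrite lie_bracketC linearN /= -reeb_eta Y0.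
  by rewrite vector_field0 oppr0.
rewrite X'0 cm_eta_xi !vector_field1 Y0// subrr !vector_field0; ring.
Qed.

(** * The covariant derivative of the Reeb field *)

Section Connection.
Context {nabla : vector_field M -> vector_field M -> vector_field M}.
Context (LC : is_levi_civita g nabla).
Local Notation h := (@cm_h _ _ M).

Lemma nablaDr U V W : nabla U (V + W) = nabla U V + nabla U W.
Proof. exact: (connectionD LC). Qed.

Lemma nablaDl U V W : nabla (U + V) W = nabla U W + nabla V W.
Proof. by have := connection_linear LC W 1 U V; rewrite !scale1r. Qed.

Lemma nabla0l W : nabla 0 W = 0.
Proof. by apply: (addrI (nabla 0 W)); rewrite -nablaDl !addr0. Qed.

Lemma nablaZl f V W : nabla (f *: V) W = f *: nabla V W.
Proof. by have := connection_linear LC W f V 0; rewrite nabla0l !addr0. Qed.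

Lemma nablaNl V W : nabla (- V) W = - nabla V W.
Proof. by rewrite -scaleN1r nablaZl scaleN1r. Qed.

Lemma nablaZr V (c : R) W :
  nabla V (smooth_cst M c *: W) = smooth_cst M c *: nabla V W.
Proof. by rewrite (connectionM LC) vector_field_cst scale0r add0r. Qed.

Lemma nabla0r V : nabla V 0 = 0.
Proof. by apply: (addrI (nabla V 0)); rewrite -nablaDr !addr0. Qed.

Lemma nablaNr V W : nabla V (- W) = - nabla V W.
Proof. by apply/eqP; rewrite -addr_eq0 -nablaDr addNr nabla0r. Qed.

Lemma eta_nabla_reeb V : eta (nabla V xi) = 0.
Proof.
apply: smooth_double_inj; rewrite -metric_xi.
have := metric_compatible LC V xi xi.
by rewrite metric_xi cm_eta_xi vector_field1 (Defs.metric_sym g xi).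
Qed.

Lemma eta_lie_bracket V W :
  eta (lie_bracket V W) = eta (nabla V W) - eta (nabla W V).
Proof. by rewrite -(torsion_free LC) linearB. Qed.

Lemma derive_eta V W : V (eta W) = eta (nabla V W) + g W (nabla V xi).
Proof. by rewrite -metric_xi (metric_compatible LC) metric_xi. Qed.

(** The Reeb orbits are geodesics: eta is invariant under the Reeb flow and xi
has constant length. *)
Lemma nabla_reeb_reeb : nabla xi xi = 0.
Proof.
apply: (@metric_ext _ _ _ g) => W; rewrite !(Defs.metric_sym g _ W) metric0r.
have := reeb_eta W; rewrite derive_eta eta_lie_bracket eta_nabla_reeb subr0.
by move=> /(canRL (addKr _)); rewrite addNr.
Qed.

Lemma reeb_eta_nabla W : xi (eta W) = eta (nabla xi W).
Proof. by rewrite derive_eta nabla_reeb_reeb metric0r addr0. Qed.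

(** The symmetric part of nabla xi, whose skew part is - phi. *)
Definition reeb_shape V : vector_field M := nabla V xi + phi V.
Local Notation S := reeb_shape.

Lemma reeb_shapeD V W : S (V + W) = S V + S W.
Proof. by rewrite /S nablaDl linearD addrACA. Qed.

Lemma reeb_shapeN V : S (- V) = - S V.
Proof. by rewrite /S nablaNl linearN opprD. Qed.

Lemma reeb_shapeZ f V : S (f *: V) = f *: S V.
Proof. by rewrite /S nablaZl linearZ scalerDr. Qed.

Lemma reeb_shape_xi : S xi = 0.
Proof. by rewrite /S nabla_reeb_reeb phi_xi addr0. Qed.

Lemma eta_reeb_shape V : eta (S V) = 0.
Proof. by rewrite /S linearD /= eta_nabla_reeb eta_phi addr0. Qed.

(** The antisymmetrization of g(nabla_V xi, W) is 2 d eta, that is 2 g(., phi .),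
which is accounted for by - phi. *)
Lemma reeb_shape_sym V W : g (S V) W = g V (S W).
Proof.
have := contact_twice V W.
rewrite !derive_eta eta_lie_bracket /S metricDl metricDr => VW.
have skew := metric_phi_skew V W.
apply/eqP; rewrite -subr_eq0; apply/eqP.
rewrite (_ : g (phi V) W = - g V (phi W)); last by rewrite skew opprK.
rewrite (Defs.metric_sym g _ W).
transitivity (g W (nabla V xi) - g V (nabla W xi) - (g V (phi W) + g V (phi W))).
  by ring.
by rewrite -VW; ring.
Qed.

(** Rewrite the invariance of g(., phi .) under the Reeb flow with
[xi, .] = nabla_xi - S + phi; the contributions of phi cancel. *)
Lemma nabla_reeb_phi_shape Z :
  nabla xi (phi Z) - phi (nabla xi Z) = - (S (phi Z) + phi (S Z)).
Proof.
apply: (@metric_ext _ _ _ g) => Y; rewrite !(Defs.metric_sym g _ Y).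
have := reeb_contact Y Z; rewrite (metric_compatible LC) -!(torsion_free LC).
have := reeb_shape_sym Y (phi Z).
rewrite /S linearB !linearD /= !metricE (metric_phi_skew Y (phi Z)) => sym E.
by apply: (eq_from_subr (congr2 (fun a b => a - b) E sym)); ring.
Qed.

Lemma nabla_reeb_phi2 Z : nabla xi (phi (phi Z)) = phi (phi (nabla xi Z)).
Proof.
rewrite !cm_phi2 nablaDr nablaNr (connectionM LC) nabla_reeb_reeb scaler0 addr0.
by rewrite reeb_eta_nabla.
Qed.

(** Since nabla_xi commutes with phi^2, S phi + phi S anticommutes with phi, that
is S phi^2 + 2 phi S phi + phi^2 S = 0. As S kills xi and takes values in
ker eta, the outer terms are both - S, so S = phi S phi; apply phi. *)
Lemma phi_reeb_shape Z : phi (S Z) = - S (phi Z).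
Proof.
have SZ : S Z = phi (S (phi Z)).
  have E1 := nabla_reeb_phi_shape (phi Z).
  have E2 := congr1 phi (nabla_reeb_phi_shape Z).
  rewrite nabla_reeb_phi2 in E1.
  rewrite linearN linearB linearD /= in E2.
  have := congr2 +%R E1 E2.
  rewrite addrA addrNK subrr -opprD => /esym/eqP; rewrite oppr_eq0 => /eqP.
  rewrite !cm_phi2 eta_reeb_shape reeb_shapeD reeb_shapeN reeb_shapeZ.
  rewrite reeb_shape_xi scale0r scaler0 !addr0 => E.
  apply/eqP; rewrite -subr_eq0; apply/eqP/vector_field_double_inj.
  rewrite -oppr0 -E; apply: vector_fieldP => f.
  by rewrite !vector_fieldE; ring.
by rewrite SZ cm_phi2 eta_reeb_shape scale0r addr0.
Qed.

Lemma nabla_reeb_phi Z : nabla xi (phi Z) = phi (nabla xi Z).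
Proof.
apply/eqP; rewrite -subr_eq0 nabla_reeb_phi_shape phi_reeb_shape.
by rewrite subrr oppr0.
Qed.

(** As nabla_xi phi = 0, the Lie derivative of phi along xi is the commutator of
phi with nabla xi = S - phi, hence 2 phi S. *)
Lemma cm_hE V : h V = phi (S V).
Proof.
rewrite /cm_h /lie_derivative_endo -!(torsion_free LC) nabla_reeb_phi.
rewrite -[RHS]vector_field_half -scalerDr; congr (_ *: _).
rewrite {1}phi_reeb_shape /S linearB !linearD /=.
by apply: vector_fieldP => f; rewrite !vector_fieldE; ring.
Qed.

Lemma nabla_reebE V : nabla V xi = - phi V - phi (h V).
Proof.
rewrite cm_hE cm_phi2 eta_reeb_shape scale0r addr0 opprK /S.
by rewrite addrC addrK.
Qed.

Lemma eta_cm_h V : eta (h V) = 0.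
Proof. by rewrite cm_hE eta_phi. Qed.

Lemma cm_hD V W : h (V + W) = h V + h W.
Proof. by rewrite !cm_hE reeb_shapeD linearD. Qed.

Lemma cm_hN V : h (- V) = - h V.
Proof. by rewrite !cm_hE reeb_shapeN linearN. Qed.

Lemma cm_hZ f V : h (f *: V) = f *: h V.
Proof. by rewrite !cm_hE reeb_shapeZ linearZ. Qed.

Lemma cm_h_phi V : h (phi V) = - phi (h V).
Proof. by rewrite !cm_hE (phi_reeb_shape V) linearN opprK. Qed.

Lemma cm_h_sym V W : g (h V) W = g V (h W).
Proof.
by rewrite !cm_hE (phi_reeb_shape W) metricNr -reeb_shape_sym metric_phi_skew opprK.
Qed.

Lemma cm_h_xi : h xi = 0.
Proof. by rewrite cm_hE reeb_shape_xi linear0. Qed.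

Lemma phi2_cm_h V : phi (phi (h V)) = - h V.
Proof. by rewrite cm_phi2 eta_cm_h scale0r addr0. Qed.

Lemma cm_phi3 V : phi (phi (phi V)) = - phi V.
Proof. by rewrite cm_phi2 eta_phi scale0r addr0. Qed.

(** If h = 0 then nabla xi = - phi is skew. *)
Lemma killing_of_h0 : (forall X, h X = 0) -> K_contact M.
Proof.
move=> h0 V W; rewrite -!(torsion_free LC) (metric_compatible LC) !nabla_reebE.
rewrite !h0 linear0 !subr0 !metricE (metric_phi_skew V W); ring.
Qed.

(** * The curvature in the Reeb direction *)

(** The Riccati equation of nabla xi along the Reeb orbits. *)
Lemma reeb_curvature X : curvature nabla xi X xi =
  phi (phi X) + h (h X) - phi (nabla xi (h X) - h (nabla xi X)).
Proof.
rewrite /curvature nabla_reeb_reeb nabla0r subr0 -(torsion_free LC) !nabla_reebE.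
rewrite nablaDr !nablaNr !nabla_reeb_phi.
rewrite !(cm_hD, cm_hN, cm_h_phi) !cm_phiE !phi2_cm_h.
by apply: vector_fieldP => f; rewrite !vector_fieldE; ring.
Qed.

Section KappaMu.
Context {kappa mu : R}.
Context (KM : is_kappa_mu_space nabla kappa mu).
Local Notation cst := (smooth_cst M).

Lemma kappa_mu_reeb X :
  cst kappa *: phi (phi X) - cst mu *: h X =
  phi (phi X) + h (h X) - phi (nabla xi (h X) - h (nabla xi X)).
Proof.
rewrite -reeb_curvature KM cm_eta_xi cm_h_xi !scale1r scaler0 sub0r scalerN.
by rewrite cm_phi2 [- X + _]addrC.
Qed.

(** Conjugating the previous identity by phi reverses the terms in phi^2 and h^2
but not those in mu and nabla_xi h, which the difference eliminates. *)
Lemma kappa_mu_h2 X : h (h X) = cst (kappa - 1) *: phi (phi X).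
Proof.
have E1 := kappa_mu_reeb X; have E2 := congr1 phi (kappa_mu_reeb (phi X)).
move: E2; rewrite nabla_reeb_phi !cm_h_phi cm_hN cm_h_phi nablaNr nabla_reeb_phi.
rewrite !cm_phiE (cm_phiZ (cst kappa)) (cm_phiZ (cst mu)) !cm_phiE !cm_phi3 !phi2_cm_h => E2.
rewrite !cm_phiE in E1.
apply/eqP; rewrite -subr_eq0; apply/eqP/vector_field_double_inj.
apply: (eq_from_subr (congr2 (fun a b => b - a) E1 E2)).
rewrite smooth_cstD smooth_cstN smooth_cst1.
by apply: vector_fieldP => f; rewrite !vector_fieldE; ring.
Qed.

Lemma metric_h X : g (h X) (h X) = cst (1 - kappa) * g (phi X) (phi X).
Proof.
rewrite cm_h_sym kappa_mu_h2 metricZr metric_phi_skew -opprB smooth_cstN.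
by ring.
Qed.

(** Where h X does not vanish, g(h X, h X) is positive; for kappa >= 1 it would
also be a nonpositive multiple of g(phi X, phi X), nonnegative at that point. *)
Lemma kappa_lt1 : ~ K_contact M -> kappa < 1.
Proof.
move=> nK; rewrite ltNge; apply/negP => k1; apply/nK/killing_of_h0 => X.
apply: vector_fieldP => f; apply: smooth_fun_ext => p; apply/eqP/contraT => hXfp.
have : 0 < g (h X) (h X) p by apply: metric_gt0; exists f.
have := metric_ge0 g (phi X) hXfp; rewrite metric_h => phi_ge0.
rewrite [X in 0 < X](_ : _ = (1 - kappa) * g (phi X) (phi X) p)//.
by rewrite ltNge mulr_le0_ge0// subr_le0.
Qed.

(** The product of X' with the curvature identity determines
g(X', phi (nabla_xi X)): h is symmetric and anticommutes with phi, so both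
terms of phi (nabla_xi h) X contribute a g(X', phi (nabla_xi X)). *)
Lemma canonical_invariant_eigen {a : R} {X X'} : a != 0 -> a ^+ 2 = 1 - kappa ->
    eigendistribution a X -> eigendistribution a X' ->
  canonical_invariant X X' = cst (2 + 2 * a - mu) * g X X'.
Proof.
move=> a0 a2 hX hX'.
have eta0 Y : h Y = cst a *: Y -> eta Y = 0.
  move=> hY; apply: (smooth_cst_divK a0).
  by have := eta_cm_h Y; rewrite hY linearZ.
have phi2X : phi (phi X) = - X by rewrite cm_phi2 eta0// scale0r addr0.
have eqG : cst kappa * g X X' = g X X' - cst a * (cst a * g X X').
  by rewrite -[kappa](subKr 1) -a2 smooth_cstD smooth_cstN smooth_cst1 smooth_cstM; ring.
have hphi : g X' (phi (h (nabla xi X))) = - (cst a * g X' (phi (nabla xi X))).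
  rewrite -[phi (h _)]opprK -cm_h_phi metricNr -cm_h_sym.
  by rewrite (hX' : h X' = _) metricZl.
have := congr1 (g X') (kappa_mu_reeb X).
rewrite phi2X (hX : h X = _) cm_hZ (hX : h X = _) nablaZr.
rewrite !cm_phiE (cm_phiZ (cst a)) !metricE hphi (Defs.metric_sym g X' X) => E.
rewrite canonical_invariantE ?eta0// -(torsion_free LC) nabla_reebE.
rewrite (hX : h X = _) !cm_phiE !(cm_phiZ (cst a)) phi2X !metricE.
rewrite (Defs.metric_sym g X' X).
apply/eqP; rewrite -subr_eq0; apply/eqP/(smooth_cst_divK a0).
rewrite !smooth_cstD smooth_cstN smooth_cstM !smooth_cstD smooth_cst1.
have E0 := congr2 +%R eqG E.
by apply: (eq_from_subr (esym E0)); ring.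
Qed.

End KappaMu.

End Connection.

End ContactMetric.

(** * The canonical invariants *)

Theorem proposition3p2 (R : realType) (n : nat)
    (M : contact_metric_manifold R n)
    (nabla : vector_field M -> vector_field M -> vector_field M)
    (kappa mu : R) :
  is_levi_civita (cm_metric M) nabla ->
  is_kappa_mu_space nabla kappa mu ->
  ~ K_contact M ->
  let lambda := Num.sqrt (1 - kappa) in
  (forall X X' : vector_field M,
     eigendistribution lambda X -> eigendistribution lambda X' ->
     canonical_invariant X X' =
       smooth_cst M (((lambda + 1) ^+ 2 - kappa - mu * lambda) / lambda)
         * cm_metric M X X') /\
  (forall X X' : vector_field M,
     eigendistribution (- lambda) X -> eigendistribution (- lambda) X' ->
     canonical_invariant X X' =
       smooth_cst M ((- (lambda - 1) ^+ 2 + kappa - mu * lambda) / lambda)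
         * cm_metric M X X').
Proof.
move=> LC KM nK lambda.
have k1 := kappa_lt1 LC KM nK.
have l0 : lambda != 0 by rewrite gt_eqF// sqrtr_gt0 subr_gt0.
have l2 : lambda ^+ 2 = 1 - kappa by rewrite sqr_sqrtr// subr_ge0 ltW.
have -> : kappa = 1 - lambda ^+ 2 by rewrite l2 subKr.
split=> X X' hX hX'.
  rewrite (canonical_invariant_eigen LC KM l0 l2)//.
  by congr (smooth_cst M _ * _); field.
rewrite (canonical_invariant_eigen LC KM _ _ hX hX') ?oppr_eq0 ?sqrrN//.
by congr (smooth_cst M _ * _); field.
Qed.
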